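(* Let $k\ge3$ and let $H$ be a connected $k$-graph with $c(H)>0$. If $H$ is not a loose cycle, then $\alpha(H)<\alpha^*$.
   Context: A $k$-graph is a simple $k$-uniform hypergraph. $\rho(H)$ is the spectral radius of the adjacency tensor (order $k$, entries $1/(k-1)!$ at index tuples forming an edge, $0$ otherwise; maximal modulus of eigenvalues $\lambda$ with $\mathcal{A}x=\lambda x^{[k-1]}$, $x\ne0$), and $\alpha(H)=\rho(H)^{-k}$. For a $k$-graph with $n$ vertices, $m$ edges and $p$ components, $c(H)=m(k-1)-n+p$. A loose cycle of length $n\ge2$ is a $k$-graph with distinct vertices $v_1,\dots,v_n$ and edges $e_1,\dots,e_n$ where $e_i$ contains $v_i,v_{i+1}$ (indices mod $n$) and $k-2$ further vertices, all these further vertices being distinct and of degree 1. $\alpha^*=\frac13(4-c^{1/3}-c^{-1/3})\approx0.24512$ with $c=(3\sqrt{69}+25)/2$, the unique root in $(0,1)$ of $(1-x)^5=x$. *)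

(* Defs.v *)
From HB Require Import structures.
From mathcomp Require Import all_boot all_order all_algebra.
From mathcomp Require Import complex.
From mathcomp Require Import boolp classical_sets reals exp.
From mathcomp Require Import ring lra.

Set Implicit Arguments.
Unset Strict Implicit.
Unset Printing Implicit Defensive.

Import Order.TTheory GRing.Theory Num.Theory.

Local Open Scope ring_scope.

Record kgraph (k : nat) (V : finType) := KGraph {
  edges : {set {set V}};
  edges_uniform : forall e : {set V}, e \in edges -> #|e| = k }.

Section Hypergraph.
Variables (k : nat) (V : finType).
Implicit Types (H : kgraph k V).

Definition adjacent H : rel V :=
  fun u v => [exists e in edges H, (u \in e) && (v \in e)].

Definition kgraph_connected H : Prop :=
  (0 < #|V|)%N /\ forall u v : V, connect (adjacent H) u v.

Definition num_components H : nat := n_comp (adjacent H) V.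

Definition cyclomatic H : int :=
  (#|edges H| * k.-1)%:Z - #|V|%:Z + (num_components H)%:Z.

Definition degree H (x : V) : nat := #|[set e in edges H | x \in e]|.

(* [v i] are the joints, [w (i, j)] for [j < k - 2] the further vertices of the
   [i]-th edge; [ordS] is the successor modulo [n]. The cycle is all of [H]:
   there are no other edges and no other vertices. *)
Definition is_loose_cycle_of_length H (n : nat) : Prop :=
  (2 <= n)%N /\
  exists (v : 'I_n -> V) (w : 'I_n * 'I_(k - 2) -> V) (e : 'I_n -> {set V}),
    [/\ injective v, injective w & forall i p, v i != w p] /\
    [/\ injective e,
        forall i, e i = [set v i; v (ordS i)] :|: [set w (i, j) | j : 'I_(k - 2)]
      & edges H = [set e i | i : 'I_n]] /\
    [/\ forall p, degree H (w p) = 1%N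
      & forall x, (exists i, x = v i) \/ (exists p, x = w p)].

Definition is_loose_cycle H : Prop := exists n, is_loose_cycle_of_length H n.

End Hypergraph.

Section Spectrum.
Variable R : realType.

(* Tensors of order [k] with indices in [V]. *)
Definition tensor (k : nat) (V : finType) := k.-tuple V -> R[i].

(* (A x^(k-1))_i is the sum of A_(i, i_2, .., i_k) x_(i_2) .. x_(i_k). *)
Definition tensor_app (k : nat) (V : finType) (A : tensor k V)
    (x : {ffun V -> R[i]}) (i : V) : R[i] :=
  \sum_(t : k.-tuple V | ohead t == Some i) A t * \prod_(j <- behead t) x j.

Definition tensor_eigenvalue (k : nat) (V : finType) (A : tensor k V)
    (lambda : R[i]) : Prop :=
  exists x : {ffun V -> R[i]},
    x != 0 /\ forall i : V, tensor_app A x i = lambda * x i ^+ k.-1.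

(* [`|lambda|] is the modulus of [lambda] as an element of [R[i]], whence the
   [Re]. The supremum is a maximum: scaling eigenvectors to have max-norm 1
   shows that the set of eigenvalues is compact. *)
Definition spectral_radius (k : nat) (V : finType) (A : tensor k V) : R :=
  sup [set r : R | exists2 lambda : R[i],
    tensor_eigenvalue A lambda & r = complex.Re `|lambda|]%classic.

Definition adjacency_tensor (k : nat) (V : finType) (H : kgraph k V) :
    tensor k V :=
  fun t => if [set x in t] \in edges H then ((k.-1)`!%:R)^-1 else 0.

Definition rho (k : nat) (V : finType) (H : kgraph k V) : R :=
  spectral_radius (adjacency_tensor H).

Definition alpha (k : nat) (V : finType) (H : kgraph k V) : R := rho H ^- k.

Definition c_star : R := (3 * Num.sqrt 69 + 25) / 2.

Definition alpha_star : R := (4 - c_star `^ (1 / 3) - c_star `^ (- (1 / 3))) / 3.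

Lemma alpha_starP (x : R) :
  0 < x < 1 /\ (1 - x) ^+ 5 = x <-> x = alpha_star.
Proof.
have s0 : 0 <= Num.sqrt (69 : R) by exact: sqrtr_ge0.
have s2 : Num.sqrt (69 : R) ^+ 2 = 69 by rewrite sqr_sqrtr.
set s := Num.sqrt (69 : R) in s0 s2.
have slo : 8 < s by nra.
have shi : s < 9 by nra.
have c0 : 0 < c_star by rewrite /c_star -/s; lra.
set t := c_star `^ (1 / 3).
have t0 : 0 < t by exact: powR_gt0.
have t3 : t ^+ 3 = c_star.
  rewrite -powR_mulrn ?ltW// -powRrM.
  have -> : 1 / 3 * 3%:R = 1 :> R by field.
  by rewrite powRr1 ?ltW.
have Ea : alpha_star = (4 - t - t^-1) / 3 by rewrite /alpha_star powRN.
have tV : t * t^-1 = 1 by rewrite mulfV ?gt_eqF.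
have cq : c_star ^+ 2 = 25 * c_star - 1 by rewrite /c_star -/s; nra.
have clo : 24 < c_star by rewrite /c_star -/s; lra.
have chi : c_star < 26 by rewrite /c_star -/s; lra.
have tlo : 2 < t.
  rewrite ltNge; apply/negP => h.
  by have := clo; rewrite -t3 !exprS expr0; nra.
have thi : t < 3.
  rewrite ltNge; apply/negP => h.
  by have := chi; rewrite -t3 !exprS expr0; nra.
have [u Eu] : exists u, u = t^-1 by exists t^-1.
rewrite -Eu in Ea tV.
have cu : u ^+ 3 = 25 - c_star.
  have c1 : c_star * u ^+ 3 = 1 by rewrite -t3 -exprMn tV expr1n.
  have : c_star * u ^+ 3 = c_star * (25 - c_star).
    by rewrite c1 mulrBr -expr2 cq; ring.
  by move/mulfI; apply; rewrite gt_eqF.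
have u0 : 0 < u by rewrite Eu invr_gt0.
have u1 : u < 1 / 2 by nra.
have cub : 1 - 5 * alpha_star + 4 * alpha_star ^+ 2 - alpha_star ^+ 3 = 0.
  have -> : 1 - 5 * alpha_star + 4 * alpha_star ^+ 2 - alpha_star ^+ 3
     = ((t ^+ 3 + u ^+ 3) + 3 * (t + u) * (t * u - 1) - 25) / 27.
    by rewrite Ea; field.
  by rewrite tV t3 cu; ring.
have a01 : 0 < alpha_star < 1 by rewrite Ea; apply/andP; split; lra.
have quint (y : R) : (1 - y) ^+ 5 - y =
    (1 - 5 * y + 4 * y ^+ 2 - y ^+ 3) * (1 - y + y ^+ 2) by ring.
split=> [[/andP[x0 x1] xE]|->]; last first.
  by split=> //; apply/eqP; rewrite -subr_eq0 quint cub mul0r.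
have xc : 1 - 5 * x + 4 * x ^+ 2 - x ^+ 3 = 0.
  have /eqP := quint x; rewrite xE subrr eq_sym mulf_eq0 => /orP[/eqP //|/eqP].
  by move=> h; exfalso; nra.
case/andP: a01; move: (alpha_star) cub => a cub a0 a1.
have E : (a - x) * (5 - 4 * (a + x) + (a ^+ 2 + a * x + x ^+ 2)) = 0.
  have -> : (a - x) * (5 - 4 * (a + x) + (a ^+ 2 + a * x + x ^+ 2)) =
    (1 - 5 * x + 4 * x ^+ 2 - x ^+ 3) - (1 - 5 * a + 4 * a ^+ 2 - a ^+ 3).
    by ring.
  by rewrite xc cub subrr.
move/eqP: E; rewrite mulf_eq0 => /orP[|/eqP h].
  by rewrite subr_eq0 => /eqP.
by exfalso; nra.
Qed.

End Spectrum.

(* Main.v *)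
(* The spectral radius dominates k * sum_e prod_(v in e) x_v / sum_v x_v^k for
   every x >= 0, because a maximizer of this quotient is an eigenvector. So it
   suffices to find vertex weights z_v = x_v^k and edge weights c_e with
   c_e^k <= a prod_(v in e) z_v and z_v <= sum_(e containing v) c_e, one of these
   being strict, where a = alpha_star.

   Since c(H) > 0, H has a nonempty core: a set F of edges each of which contains
   at least two joints, i.e. vertices lying in two or more edges of F. With
   b (1 - b) = a and b < 1/2, let the joints at distance d from a chosen place have
   weight (1 - a)^d, and let c_e be b times the largest weight on e. Every other
   joint v gets (1 - b) z_v from an edge towards the place and at least b z_v from
   another edge. At the place there is room to spare if it is a joint of degree at
   least 3 or an edge with at least 3 joints. If F is a maximal core without such
   a place, then either F is all of H, which is therefore a loose cycle, or another
   edge is attached to F at a single vertex; b = (1 - b) (1 - a) is exactly the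
   relation that balances an edge attached at a vertex that is not a joint. *)

From mathcomp Require Import boolp classical_sets exp topology normedtype.
From mathcomp Require Import derive realfun.
Require Import Defs.
From mathcomp Require Import all_boot all_order all_algebra.
From mathcomp Require Import reals.
From mathcomp Require Import complex.
From mathcomp Require Import ring lra zify.

Set Implicit Arguments.
Unset Strict Implicit.
Unset Printing Implicit Defensive.

Import Order.TTheory GRing.Theory Num.Theory.
Import numFieldNormedType.Exports.

Local Open Scope ring_scope.

(** * The eigenvalue equation *)

(** A tuple of length [#|A|] with entry set [A] lists [A] without repetition, so each of the n!
    orderings of [A] contributes the same product. *)
Lemma sum_uniq_tuples (K : comNzRingType) (V : finType) (n : nat) (A : {set V})
    (x : V -> K) : #|A| = n ->
  \sum_(t : n.-tuple V | [set u in t] == A) \prod_(j <- t) x j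
    = (n`!)%:R * \prod_(u in A) x u.
Proof.
move=> An.
have uniqP (t : n.-tuple V) : ([set u in t] == A) = all (mem A) t && uniq t.
  apply/eqP/andP => [tA|[/allP tA ut]].
    split; first by apply/allP => u ut; rewrite /= -tA inE.
    by apply/card_uniqP; rewrite -cardsE tA size_tuple.
  apply/eqP; rewrite eqEcard; apply/andP; split.
    by apply/subsetP => u; rewrite inE => /tA.
  by rewrite cardsE (card_uniqP ut) size_tuple An.
transitivity (\sum_(t : n.-tuple V | [set u in t] == A) \prod_(u in A) x u).
  apply: eq_bigr => t; rewrite uniqP => /andP[tA ut].
  have /eqP <- : [set u in t] == A by rewrite uniqP tA ut.
  by rewrite big_uniq //=; apply: eq_bigl => u; rewrite inE.
rewrite sumr_const -[X in _ *+ X]cardsE.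
have -> : [set t : n.-tuple V | [set u in t] == A]
    = [set t : n.-tuple V | all (mem A) t & uniq t].
  by apply/setP => t; rewrite !inE uniqP.
by rewrite card_uniq_tuples An ffactnn mulr_natl.
Qed.

(** The entries 1/(k-1)! cancel against the (k-1)! orderings of the rest of an edge through [i]. *)
Lemma tensor_app_adjacency (R : realType) (k : nat) (V : finType)
    (H : kgraph k V) (x : {ffun V -> R[i]}) (i : V) : (0 < k)%N ->
  tensor_app (adjacency_tensor R H) x i =
    \sum_(e in edges H | i \in e) \prod_(u in e :\ i) x u.
Proof.
case: k H => // k H _; rewrite /tensor_app.
rewrite (reindex (fun t : k.-tuple V => [tuple of i :: t])) /=; last first.
  exists (fun t : k.+1.-tuple V => [tuple of behead t]) => t.
    by move=> _; apply: val_inj.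
  by rewrite inE; case/tupleP: t => a t /= /eqP[->]; apply: val_inj.
rewrite (eq_bigl (fun=> true)); last by move=> t; rewrite eqxx.
have consE (t : k.-tuple V) (e : {set V}) : e \in edges H -> i \in e ->
    ([set u in i :: t] == e) = ([set u in t] == e :\ i).
  move=> eH ie; rewrite set_cons.
  apply/eqP/eqP => [te|->]; last by rewrite setD1K.
  have /andP[it _] : uniq (i :: t).
    apply/card_uniqP; rewrite /= size_tuple -(edges_uniform eH) -te -set_cons.
    by rewrite cardsE.
  by rewrite -te setU1K // inE.
(* The tensor entry is spread over all edges through [i], at most one of which matches the tuple;
   then the sums over tuples and over edges can be exchanged. *)
rewrite (eq_bigr (fun t : k.-tuple V =>
    \sum_(e in edges H | i \in e)
      if [set u in t] == e :\ i then (k`!%:R)^-1 * \prod_(j <- t) x j else 0));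
  last first.
  move=> t _; rewrite /adjacency_tensor /=.
  case: ifPn => [tH|tH].
    rewrite (bigD1 [set u in i :: t]) /=; last by rewrite tH inE mem_head.
    have iS : i \in [set u in i :: t] by rewrite inE mem_head.
    rewrite -consE // eqxx [X in _ + X]big1 ?addr0 // => e /andP[/andP[eH ie]].
    by rewrite -consE // eq_sym => /negPf ->.
  rewrite mul0r big1 // => e /andP[eH ie].
  by rewrite -consE //; case: eqP => // te; rewrite te eH in tH.
rewrite exchange_big /=; apply: eq_bigr => e /andP[eH ie].
rewrite -big_mkcond -big_distrr sum_uniq_tuples /=.
  by rewrite mulKf // pnatr_eq0 -lt0n fact_gt0.
by have := cardsD1 i e; rewrite ie (edges_uniform eH) => -[].
Qed.

(** * The variational bound *)

(** Convexity: t^n lies above its tangent at [a]. Every summand in the factorisation of t^n - a^n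
    deviates from a^(n-1) in the direction of t - a. *)
Lemma exprB_le (R : realDomainType) (n : nat) (a t : R) : 0 <= a -> 0 <= t ->
  (t - a) * (n%:R * a ^+ n.-1) <= t ^+ n - a ^+ n.
Proof.
case: n => [|n] a0 t0 /=; first by rewrite !expr0 mul0r mulr0 subrr.
rewrite subrXX -subr_ge0 -mulrBr mulr_natl -[X in _ *+ X]card_ord -sumr_const.
rewrite -sumrB mulr_sumr sumr_ge0 // => i _ /=.
have -> : a ^+ n = a ^+ (n - i) * a ^+ i by rewrite -exprD subnK // -ltnS.
rewrite /= -mulrBl mulrA mulr_ge0 ?exprn_ge0 //.
have [at_|ta] := lerP a t.
  by apply: mulr_ge0; rewrite subr_ge0 // lerXn2r.
by rewrite mulr_le0 // subr_le0 ?lerXn2r // ltW.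
Qed.

(** Stationarity at a minimum on the half-line. At the boundary point [a = 0] minimality gives only
    one inequality; [0 <= Q] and [1 < k] supply the other. *)
Lemma min_monomial_sub_linear (R : realType) (k : nat) (M Q a : R) :
    (1 < k)%N -> 0 <= M -> 0 <= Q -> 0 <= a ->
    (forall t, 0 <= t -> M * a ^+ k - Q * a <= M * t ^+ k - Q * t) ->
  Q = k%:R * M * a ^+ k.-1.
Proof.
move=> k1 M0 Q0 a0 amin; pose f (t : R) := k%:R * M * t ^+ k.-1.
have cf : continuous f.
  move=> t; apply: cvgM; first exact: cvg_cst.
  exact: exprn_continuous.
(* Convexity with base point [t] bounds M (t^k - a^k) by (t - a) f t. Letting [t] tend to [a] from
   either side pins [Q] to [f a] by continuity alone. *)
have fP t : 0 <= t -> (t - a) * Q <= (t - a) * f t.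
  move=> t0; have := amin t t0; have := exprB_le k t0 a0.
  move=> /(ler_wpM2l M0); rewrite /f; lra.
have near_a (P : R -> Prop) : (\forall t \near a, P t) ->
    exists2 e : R, 0 < e & forall t, `|a - t| < e -> P t.
  by move/nbhs_ballP => [e /= e0 eP]; exists e => // t at_; apply: eP.
have [Qf|fQ|//] := ltgtP Q (f a).
- have [e e0 eP] := near_a _ (cvgr_gt (f a) (cf a) _ Qf).
  have [a00|a_neq0] := eqVneq a 0.
    have := eP a; rewrite subrr normr0 => /(_ e0).
    rewrite /f a00 expr0n; case: eqP => [|_]; first by move=> ?; exfalso; lia.
    by rewrite mulr0 ltNge Q0.
  have a_gt0 : 0 < a by rewrite lt_def a_neq0.
  pose t := Num.max 0 (a - e / 2).
  have t0 : 0 <= t by rewrite /t le_max lexx.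
  have ta : t < a by rewrite /t gt_max a_gt0 /= ltrBlDr ltrDl divr_gt0.
  have et : a - e / 2 <= t by rewrite /t le_max lexx orbT.
  have := fP t t0; rewrite ler_nM2l ?subr_lt0 // leNgt eP //.
  rewrite gtr0_norm ?subr_gt0 //; lra.
- have [e e0 eP] := near_a _ (cvgr_lt (f a) (cf a) _ fQ).
  have t0 : 0 <= a + e / 2 by lra.
  have := fP _ t0; rewrite ler_pM2l; last by lra.
  rewrite leNgt eP // opprD addNKr normrN gtr0_norm ?divr_gt0 //; lra.
Qed.

(** The Lagrangian polynomial of [H]; [k] times it is the form of degree [k] attached to the
    adjacency tensor. *)
Definition edge_poly (R : realType) (k : nat) (V : finType) (H : kgraph k V)
    (x : V -> R) : R :=
  \sum_(e in edges H) \prod_(v in e) x v.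

(** The nonnegative part of the unit sphere of the [k]-norm is a closed subset of the cube [0,1]^V,
    which is compact by Tychonoff. *)
Lemma edge_poly_max_on_sphere (R : realType) (k : nat) (V : finType)
    (H : kgraph k V) : (0 < k)%N -> (0 < #|V|)%N ->
  exists x : V -> R, [/\ forall v, 0 <= x v, \sum_v x v ^+ k = 1 &
    forall y : V -> R, (forall v, 0 <= y v) -> \sum_v y v ^+ k = 1 ->
      edge_poly H y <= edge_poly H x].
Proof.
move=> k0 /card_gt0P[v0 _].
pose T := prod_topology (fun _ : V => R : topologicalType).
have proj_cont v : continuous (fun f : T => f v).
  exact: (@proj_continuous V (fun=> R : topologicalType) v).
have N_cont : continuous (fun f : T => \sum_v f v ^+ k).
  apply: continuous_big; first exact: add_continuous.
  move=> v _ f; apply: (@continuous_comp _ _ _ (fun f : T => f v)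
    (fun t : R => t ^+ k)); first exact: proj_cont.
  exact: exprn_continuous.
have P_cont : continuous (fun f : T => edge_poly H f).
  apply: continuous_big; first exact: add_continuous.
  move=> e _; apply: continuous_big; first exact: mul_continuous.
  by move=> v _; exact: proj_cont.
pose cube : set T := [set f : T | forall v, `[0, 1]%classic (f v)]%classic.
pose sph : set T := ((fun f : T => \sum_v f v ^+ k) @^-1` [set t | t = 1])%classic.
have cK : compact (cube `&` sph)%classic.
  apply: compact_closedI.
    apply: (@tychonoff V (fun=> R : topologicalType) (fun=> `[0, 1]%classic)) => v.
    exact: segment_compact.
  apply: (@preimage_closed T R _ [set t | t = 1]%classic) => [f _|].
    exact: N_cont.
  exact: closed_eq.
have inK (y : V -> R) : (forall v, 0 <= y v) -> \sum_v y v ^+ k = 1 ->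
    (cube `&` sph)%classic y.
  move=> y0 y1; split => // v /=; rewrite in_itv /= y0 /=.
  rewrite -(@expr_le1 _ k) // -y1 (bigD1 v) //= lerDl sumr_ge0 // => u _.
  exact: exprn_ge0.
have K0 : (cube `&` sph !=set0)%classic.
  exists (fun v => (v == v0)%:R); apply: inK => [v|]; first exact: ler0n.
  rewrite (bigD1 v0) //= eqxx expr1n big1 ?addr0 // => v /negPf ->.
  by rewrite expr0n gtn_eqF.
have [x /set_mem[/= xc xs] xmax] :=
  compact_EVT_max K0 cK (continuous_subspaceT P_cont).
exists x; split => [v||y y0 y1].
- by have := xc v; rewrite /= in_itv /= => /andP[].
- exact: xs.
- by apply: xmax; apply/mem_set; exact: inK.
Qed.

Lemma edge_poly_scale (R : realType) (k : nat) (V : finType) (H : kgraph k V)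
    (s : R) (x : V -> R) :
  edge_poly H (fun v => s * x v) = s ^+ k * edge_poly H x.
Proof.
rewrite /edge_poly big_distrr /=; apply: eq_bigr => e eH.
by rewrite big_split /= prodr_const (edges_uniform eH).
Qed.

Lemma edge_poly_ge0 (R : realType) (k : nat) (V : finType) (H : kgraph k V)
    (x : V -> R) : (forall v, 0 <= x v) -> 0 <= edge_poly H x.
Proof. by move=> x0; apply: sumr_ge0 => e _; apply: prodr_ge0. Qed.

Lemma exists_root (R : realType) (k : nat) (a : R) : (0 < k)%N -> 0 <= a ->
  exists2 b : R, 0 <= b & b ^+ k = a.
Proof.
move=> k0 a0; exists (a `^ k%:R^-1); first exact: powR_ge0.
rewrite -powR_mulrn ?powR_ge0 // -powRrM mulVf ?powRr1 //.
by rewrite pnatr_eq0 -lt0n.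
Qed.

(** Both sides are homogeneous of degree [k], so the maximum over the sphere bounds every
    nonnegative vector after rescaling. *)
Lemma edge_poly_max (R : realType) (k : nat) (V : finType) (H : kgraph k V) :
    (0 < k)%N -> (0 < #|V|)%N ->
  exists x : V -> R, exists M : R, [/\ forall v, 0 <= x v, exists v, x v != 0,
    M * (\sum_v x v ^+ k) = edge_poly H x &
    forall y : V -> R, (forall v, 0 <= y v) ->
      edge_poly H y <= M * \sum_v y v ^+ k].
Proof.
move=> k0 V0; have [x [x0 x1 xmax]] := edge_poly_max_on_sphere R H k0 V0.
exists x, (edge_poly H x); split; rewrite ?x1 ?mulr1 //.
  have [/existsP //|/existsPn xz] := boolP [exists v, x v != 0].
  move: x1; rewrite big1 => [/eqP|v _]; first by rewrite eq_sym oner_eq0.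
  by have /negPn/eqP -> := xz v; rewrite expr0n gtn_eqF.
move=> y y0; set N := \sum_v y v ^+ k.
have N0 : 0 <= N by apply: sumr_ge0 => v _; apply: exprn_ge0.
have [s s0 sN] := exists_root k0 N0.
have [N00|NN0] := eqVneq N 0.
  have y00 v : y v = 0.
    move/eqP: N00; rewrite psumr_eq0 => [/allP /(_ v)|u _]; last exact: exprn_ge0.
    by rewrite mem_index_enum expf_eq0 k0 => /(_ isT)/eqP.
  rewrite N00 mulr0 /edge_poly big1 // => e eH.
  have /card_gt0P[v ve] : (0 < #|e|)%N by rewrite (edges_uniform eH).
  by rewrite (bigD1 v) //= y00 mul0r.
have sn0 : s != 0.
  by apply: contraNneq NN0 => s00; rewrite -sN s00 expr0n gtn_eqF.
have -> : edge_poly H y = s ^+ k * edge_poly H (fun v => s^-1 * y v).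
  by rewrite edge_poly_scale mulrA -exprMn mulfV // expr1n mul1r.
rewrite sN mulrC ler_wpM2r //; apply: xmax => [v|].
  by rewrite mulr_ge0 ?invr_ge0.
under eq_bigr do rewrite exprMn.
by rewrite -big_distrr /= -/N -sN exprVn mulVf // expf_neq0.
Qed.

Lemma ltr_sum_strict (R : numDomainType) (I : finType) (P : pred I)
    (F G : I -> R) (j : I) :
    (forall i, P i -> F i <= G i) -> P j -> F j < G j ->
  \sum_(i | P i) F i < \sum_(i | P i) G i.
Proof.
move=> FG Pj FGj; rewrite (bigD1 j) // [ltRHS](bigD1 j) //=.
by rewrite ltr_leD // ler_sum // => i /andP[/FG].
Qed.

(** With all coordinates but the one at [i] frozen, the difference of the two sides of the bound is
    M t^k - Q t plus a constant, minimal at t = [x i]. Stationarity there is the eigenvalue equation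
    at [i]. *)
Lemma edge_poly_max_eigenvalue (R : realType) (k : nat) (V : finType)
    (H : kgraph k V) (x : V -> R) (M : R) :
    (1 < k)%N -> (forall v, 0 <= x v) -> (exists v, x v != 0) ->
    M * (\sum_v x v ^+ k) = edge_poly H x ->
    (forall y : V -> R, (forall v, 0 <= y v) ->
      edge_poly H y <= M * \sum_v y v ^+ k) ->
  0 <= M /\ tensor_eigenvalue (adjacency_tensor R H) ((k%:R * M)%:C)%C.
Proof.
move=> k1 x0 [v xv] Mx xmax.
have k0 : (0 < k)%N by apply: ltnW.
have M0 : 0 <= M.
  have N0 : 0 < \sum_u x u ^+ k.
    rewrite (bigD1 v) //= ltr_pwDl ?exprn_gt0 ?lt_def ?xv ?x0 //.
    by apply: sumr_ge0 => u _; apply: exprn_ge0.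
  by rewrite -(pmulr_lge0 _ N0) Mx edge_poly_ge0.
split=> //; exists [ffun u => ((x u)%:C)%C]; split.
  apply/eqP => /ffunP /(_ v); rewrite !ffunE => /eqP.
  by rewrite (inj_eq (@complexI R)) (negPf xv).
move=> i; rewrite tensor_app_adjacency // ffunE.
pose Q := \sum_(e in edges H | i \in e) \prod_(u in e :\ i) x u.
have Q0 : 0 <= Q.
  by apply: sumr_ge0 => e _; apply: prodr_ge0.
suff QE : Q = k%:R * M * x i ^+ k.-1.
  rewrite -rmorphXn -rmorphM /= -QE rmorph_sum /=; apply: eq_bigr => e _.
  by rewrite rmorph_prod; apply: eq_bigr => u _; rewrite ffunE.
apply: min_monomial_sub_linear => // t t0.
pose y u := if u == i then t else x u.
have y0 u : 0 <= y u by rewrite /y; case: ifP.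
pose r := \sum_(e in edges H | i \notin e) \prod_(u in e) x u.
have splitP (w : V -> R) : (forall u, u != i -> w u = x u) ->
    edge_poly H w = w i * Q + r.
  move=> wx; rewrite /edge_poly (bigID (fun e : {set V} => i \in e)) /=.
  congr (_ + _).
    rewrite big_distrr /=; apply: eq_bigr => e /andP[_ ie].
    rewrite (big_setD1 i) //=; congr (_ * _); apply: eq_bigr => u.
    by rewrite !inE => /andP[/wx].
  apply: eq_bigr => e /andP[_ ie]; apply: eq_bigr => u ue.
  by apply: wx; apply: contraNneq ie => <-.
have splitN (w : V -> R) : (forall u, u != i -> w u = x u) ->
    \sum_u w u ^+ k = w i ^+ k + \sum_(u | u != i) x u ^+ k.
  move=> wx; rewrite (bigD1 i) //=; congr (_ + _).
  by apply: eq_bigr => u /wx ->.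
have yx u : u != i -> y u = x u by rewrite /y => /negPf ->.
have yi : y i = t by rewrite /y eqxx.
have := xmax y y0; move: Mx.
by rewrite (splitP x) // (splitP y) // (splitN x) // (splitN y) // yi; lra.
Qed.

Lemma alpha_lt_of_eigenvalue (R : realType) (k : nat) (V : finType) (H : kgraph k V)
    (a lam : R) :
    (0 < k)%N -> 0 < a -> 0 <= lam ->
    tensor_eigenvalue (adjacency_tensor R H) (lam%:C)%C ->
    1 < a * lam ^+ k ->
  alpha R H < a.
Proof.
move=> k0 a0 lam0 Hlam alam; rewrite /alpha /rho /spectral_radius.
set S := (X in sup X).
(* Without a supremum [sup] returns 0; then [alpha R H] is the inverse of 0, which is 0, and the
   claim reads [0 < a]. *)
have [Ssup|/sup_out ->] := pselect (has_sup S); last first.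
  by rewrite expr0n gtn_eqF //= invr0.
have lamS : lam <= sup S.
  apply: (sup_upper_bound Ssup); exists (lam%:C)%C => //.
  by rewrite normc_def /= expr0n addr0 sqrtr_sqr ger0_norm.
have lamk : lam ^+ k <= sup S ^+ k by rewrite lerXn2r // nnegrE (le_trans lam0).
have lt1 : 1 < a * sup S ^+ k by apply: lt_le_trans alam _; rewrite ler_pM2l.
have S0 : 0 < sup S ^+ k.
  by rewrite -(pmulr_rgt0 _ a0) (lt_trans ltr01).
by rewrite -(ltr_pM2r S0) mulVf ?gt_eqF.
Qed.

(* In Lu and Man's terms, [c e / z v] is a consistent [a]-supernormal weighted
   incidence matrix; the test vector is the [k]-th root of [z]. *)
Lemma alpha_lt_supernormal (R : realType) (k : nat) (V : finType)
    (H : kgraph k V) (a : R) (G : {set {set V}}) (z : V -> R)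
    (c : {set V} -> R) :
    (1 < k)%N -> 0 < a -> G \subset edges H -> (forall v, 0 <= z v) ->
    {in G, forall e, c e ^+ k <= a * \prod_(v in e) z v} ->
    (forall v, z v <= \sum_(e in G | v \in e) c e) ->
    (exists v, z v < \sum_(e in G | v \in e) c e) \/
    (exists2 e, e \in G & c e ^+ k < a * \prod_(v in e) z v) ->
  alpha R H < a.
Proof.
move=> k1 a0 GH z0 cz zc strict; have k0 : (0 < k)%N by apply: ltnW.
have V0 : (0 < #|V|)%N.
  case: strict => [[v _]|[e /(subsetP GH) eH _]]; first by apply/card_gt0P; exists v.
  by apply: leq_trans (max_card (mem e)); rewrite (edges_uniform eH).
have [x [M [x0 xn0 Mx xmax]]] := edge_poly_max R H k0 V0.
have [M0 eigM] := edge_poly_max_eigenvalue k1 x0 xn0 Mx xmax.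
apply: (@alpha_lt_of_eigenvalue _ _ _ _ _ (k%:R * M)) => //; first by rewrite mulr_ge0.
have [b b0 bk] := exists_root k0 (ltW a0).
have /choice[y yP] : forall v, exists t : R, 0 <= t /\ t ^+ k = z v.
  by move=> v; have [t t0 tk] := exists_root k0 (z0 v); exists t.
have y0 v : 0 <= y v by have [] := yP v.
(* [g e] is the [k]-th root of the right side of the edge condition, which therefore becomes
   [c e <= g e], also for negative [c e]. *)
pose g (e : {set V}) := b * \prod_(v in e) y v.
have g0 e : 0 <= g e by rewrite mulr_ge0 ?prodr_ge0.
have gk e : g e ^+ k = a * \prod_(v in e) z v.
  rewrite exprMn bk -prodrXl; congr (_ * _); apply: eq_bigr => v _.
  by have [] := yP v.
have cg e : e \in G -> c e <= g e.
  move=> eG; have [c0|/ltW c0] := lerP 0 (c e); last exact: le_trans c0 (g0 e).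
  by rewrite -(ler_pXn2r k0) ?nnegrE // gk cz.
(* Double counting of incidences: every edge has [k] vertices. *)
have dsum : \sum_v \sum_(e in G | v \in e) c e = \sum_(e in G) k%:R * c e.
  rewrite (exchange_big_dep (mem G)) /= => [|v e _ /andP[]//].
  apply: eq_bigr => e eG; rewrite eG /= sumr_const mulr_natl.
  by rewrite (edges_uniform (subsetP GH e eG)).
have z_le : \sum_v z v <= \sum_(e in G) k%:R * c e.
  by rewrite -dsum; apply: ler_sum => v _.
have g_le : \sum_(e in G) k%:R * c e <= \sum_(e in G) k%:R * g e.
  by apply: ler_sum => e eG; rewrite ler_wpM2l ?cg.
have lt_zg : \sum_v z v < \sum_(e in G) k%:R * g e.
  case: strict => [[v zv]|[e eG ce]].
    apply: lt_le_trans g_le; rewrite -dsum.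
    by apply: (ltr_sum_strict _ (isT : predT v) zv) => u _.
  apply: le_lt_trans z_le _; apply: (ltr_sum_strict _ eG) => [f fG|].
    by rewrite ler_wpM2l ?cg.
  rewrite ltr_pM2l ?ltr0n //; have [c0|c0] := lerP 0 (c e).
    by rewrite -(ltr_pXn2r k0) ?nnegrE // gk.
  exact: lt_le_trans c0 (g0 e).
have sum_g : \sum_(e in G) k%:R * g e <= b * (k%:R * M) * \sum_v z v.
  have -> : \sum_v z v = \sum_v y v ^+ k by apply: eq_bigr => v _; case: (yP v).
  have := xmax y y0; have bk0 : 0 <= b * k%:R by rewrite mulr_ge0.
  move=> /(ler_wpM2l bk0); rewrite !mulrA; apply: le_trans.
  rewrite /edge_poly big_distrr /= [leRHS](big_setID G) /=.
  rewrite (setIidPr GH) -[leLHS]addr0 lerD //; last first.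
    by apply: sumr_ge0 => e _; rewrite mulr_ge0 ?prodr_ge0.
  by apply: ler_sum => e _; rewrite /g mulrA [b * _]mulrC.
have z_ge0 : 0 <= \sum_v z v by apply: sumr_ge0.
(* If b k M were at most 1, then sum z < k sum g <= b k M sum z <= sum z, which is absurd. *)
have bM : 1 < b * (k%:R * M).
  rewrite ltNge; apply/negP => bM1; have := lt_le_trans lt_zg sum_g.
  by rewrite ltNge ler_piMl.
by rewrite -bk -exprMn exprn_egt1 // -lt0n.
Qed.

(* Off the joints [J], every vertex lies in at most one edge [e] of [G] and gets
   weight [c e], which makes the vertex condition tight and contributes equally
   to both sides of the edge condition. *)
Lemma alpha_lt_joints (R : realType) (k : nat) (V : finType) (H : kgraph k V)
    (a : R) (G : {set {set V}}) (J : {set V}) (y : V -> R) (c : {set V} -> R) :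
    (1 < k)%N -> 0 < a -> G \subset edges H ->
    (forall v, 0 <= y v) -> (forall e, 0 <= c e) ->
    (forall v e f, v \notin J -> e \in G -> f \in G -> v \in e -> v \in f ->
      e = f) ->
    {in G, forall e, c e ^+ #|e :&: J| <= a * \prod_(v in e :&: J) y v} ->
    {in J, forall v, y v <= \sum_(e in G | v \in e) c e} ->
    (exists2 v, v \in J & y v < \sum_(e in G | v \in e) c e) \/
    (exists2 e, e \in G &
      0 < c e /\ c e ^+ #|e :&: J| < a * \prod_(v in e :&: J) y v) ->
  alpha R H < a.
Proof.
move=> k1 a0 GH y0 c0 uniqJ cy yc strict.
pose z v := if v \in J then y v else \sum_(e in G | v \in e) c e.
have zE e v : e \in G -> v \in e :\: J -> z v = c e.
  move=> eG; rewrite inE /z => /andP[vJ ve]; rewrite (negPf vJ).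
  rewrite (bigD1 e) /= ?eG // big1 ?addr0 // => f /andP[/andP[fG vf]].
  by rewrite (uniqJ _ _ _ vJ eG fG ve vf) eqxx.
have zprod e : e \in G ->
    \prod_(v in e) z v = (\prod_(v in e :&: J) y v) * c e ^+ #|e :\: J|.
  move=> eG; rewrite (big_setID J) /=; congr (_ * _).
    by apply: eq_bigr => v; rewrite inE /z => /andP[_ ->].
  by rewrite -prodr_const; apply: eq_bigr => v /(zE _ _ eG).
have cprod e : e \in G -> c e ^+ k = c e ^+ #|e :&: J| * c e ^+ #|e :\: J|.
  by move=> eG; rewrite -exprD cardsID (edges_uniform (subsetP GH e eG)).
apply: (@alpha_lt_supernormal _ _ _ _ _ G z c) => //.
- by move=> v; rewrite /z; case: ifP => // _; apply: sumr_ge0.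
- by move=> e eG; rewrite cprod // zprod // mulrA ler_wpM2r ?exprn_ge0 ?cy.
- by move=> v; rewrite /z; case: ifP => // vJ; apply: yc.
case: strict => [[v vJ yv]|[e eG [ce cye]]]; [left|right].
  by exists v; rewrite /z vJ.
by exists e; rewrite // cprod // zprod // mulrA ltr_pM2r ?exprn_gt0.
Qed.

(** * Cores *)

Definition joints (V : finType) (F : {set {set V}}) : {set V} :=
  [set v | 1 < #|[set e in F | v \in e]|]%N.

Definition is_core (V : finType) (F : {set {set V}}) : bool :=
  [forall e in F, 1 < #|e :&: joints F|]%N.

Lemma jointP (V : finType) (F : {set {set V}}) (v : V) :
  reflect (exists e f, [/\ e \in F, f \in F, v \in e, v \in f & e != f])
    (v \in joints F).
Proof.
rewrite inE; apply: (iffP card_gt1P).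
  move=> [e [f [he hf ef]]]; move: he hf; rewrite !inE.
  by move=> /andP[eF ve] /andP[fF vf]; exists e, f.
move=> [e [f [eF fF ve vf ef]]]; exists e, f; split => //; rewrite inE.
  by rewrite eF.
by rewrite fF.
Qed.

Lemma not_joint_uniq (V : finType) (F : {set {set V}}) (v : V) (e f : {set V}) :
  v \notin joints F -> e \in F -> f \in F -> v \in e -> v \in f -> e = f.
Proof.
move=> vJ eF fF ve vf; apply/eqP; apply: contraNT vJ => ef.
by apply/jointP; exists e, f.
Qed.

Lemma joint_other_edge (V : finType) (F : {set {set V}}) (v : V) (e : {set V}) :
  v \in joints F -> exists f, [/\ f \in F, v \in f & f != e].
Proof.
move/jointP => [f [g [fF gF vf vg fg]]].
have [fe|fe] := eqVneq f e; last by exists f.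
by exists g; rewrite -fe eq_sym.
Qed.

Lemma joints_cover (V : finType) (F : {set {set V}}) : joints F \subset cover F.
Proof.
apply/subsetP => v /jointP[e [f [eF _ ve _ _]]].
by apply/bigcupP; exists e.
Qed.

Lemma joints_sub (V : finType) (F G : {set {set V}}) :
  F \subset G -> joints F \subset joints G.
Proof.
move=> /subsetP FG; apply/subsetP => v /jointP[e [f [eF fF ve vf ef]]].
by apply/jointP; exists e, f; split => //; apply: FG.
Qed.

Lemma coreP (V : finType) (F : {set {set V}}) :
  reflect {in F, forall e, (1 < #|e :&: joints F|)%N} (is_core F).
Proof. by apply: (iffP forall_inP). Qed.

(** A minimal nonempty family satisfying the counting bound is a core. An edge with at most one
    joint could be dropped: at least k-1 of its vertices lie in no other edge, so the cover shrinks
    at least as much as the bound. *)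
Lemma exists_core (V : finType) (k : nat) (E : {set {set V}}) :
    (0 < k)%N -> {in E, forall e : {set V}, #|e| = k} -> E != set0 ->
    (#|cover E| <= #|E| * k.-1)%N ->
  exists F : {set {set V}}, [/\ F \subset E, F != set0 & is_core F].
Proof.
move=> k0 Ek E0 cE.
pose P (F : {set {set V}}) := [&& F != set0 & (#|cover F| <= #|F| * k.-1)%N].
have [F /minsetP[/andP[F0 cF] Fmin] FE] : {F | minset P F & F \subset E}.
  by apply: minset_exists; rewrite /P E0.
exists F; split => //; apply/coreP => e eF.
have ek : #|e| = k by apply: Ek; apply: (subsetP FE).
have cardF : #|F| = #|F :\ e|.+1 by rewrite (cardsD1 e) eF.
have coverF : cover F = cover (F :\ e) :|: e.
  by rewrite -{1}(setD1K eF) /cover bigcup_setU big_set1 setUC.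
have cIe : (#|e :&: cover (F :\ e)| <= #|e :&: joints F|)%N.
  apply/subset_leq_card/subsetP => v; rewrite !in_setI => /andP[ve].
  rewrite ve /= => /bigcupP[f]; rewrite in_setD1 => /andP[fe fF] vf.
  by apply/jointP; exists f, e.
apply: leq_trans cIe.
have := cardsUI (cover (F :\ e)) e; rewrite -coverF ek setIC => cUI.
(* A single edge violates the bound, as it covers [k] vertices and only k-1 are allowed. *)
have [F1|F1] := eqVneq (F :\ e) set0.
  move: cF; rewrite cardF coverF F1 /cover big_set0 set0U ek cards0 mul1n; lia.
have : ~~ P (F :\ e).
  apply/negP => PF; have := Fmin _ PF (subsetDl _ _).
  by move/setP/(_ e); rewrite eF !inE eqxx.
rewrite /P F1 /= -ltnNge; move: cF; rewrite cardF mulSn.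
move: cUI k0; move: (#|F :\ e| * k.-1)%N #|cover F| #|cover (F :\ e)| => p q r.
by move: #|_| => s; lia.
Qed.

(** * Geometric weights on a core *)

(** [y v] is q^d with d the [g]-distance from [S], and 0 where [S] does not lead. Unreachable points
    do occur, since a core need not be connected; hence the premise [0 < y v] in the last clause. *)
Lemma geometric_levels (R : realType) (V : finType) (g : rel V) (S : {set V})
    (q : R) : 0 < q -> q <= 1 ->
  exists y : V -> R, [/\ forall v, 0 <= y v, {in S, forall v, y v = 1},
    forall u v, g u v -> q * y u <= y v &
    forall v, v \notin S -> 0 < y v -> exists2 u, g u v & y v = q * y u].
Proof.
move=> q0 q1.
(* [L n] holds the endpoints of walks of exactly [n] steps from [S]; the least such [n] is the
   distance. *)
pose L := fix L n : {set V} :=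
  if n is m.+1 then [set v | [exists u in L m, g u v]] else S.
have LS n u v : u \in L n -> g u v -> v \in L n.+1.
  by move=> uL guv; rewrite /= inE; apply/exists_inP; exists u.
pose spec v (t : R) := (exists n, [/\ v \in L n, forall m, v \in L m -> (n <= m)%N
  & t = q ^+ n]) \/ ((forall n, v \notin L n) /\ t = 0).
have /choice[y yP] : forall v, exists t, spec v t.
  move=> v; have [ex|nex] := pselect (exists n, v \in L n).
    exists (q ^+ ex_minn ex); left; exists (ex_minn ex).
    by case: ex_minnP => n vn nmin; split.
  exists 0; right; split=> // n; apply/negP => vn; apply: nex.
  by exists n.
have yL n v : v \in L n -> q ^+ n <= y v.
  move=> vn; have [[m [_ mmin ->]]|[/(_ n)]] := yP v; last by rewrite vn.
  by apply: ler_wiXn2l; rewrite ?(ltW q0) ?mmin.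
exists y; split.
- move=> v; have [[m [_ _ ->]]|[_ ->//]] := yP v.
  by rewrite exprn_ge0 // ltW.
- move=> v vS; have [[m [_ mmin ->]]|[/(_ 0%N)]] := yP v; last by rewrite /= vS.
  by have := mmin 0%N vS; rewrite leqn0 => /eqP ->.
- move=> u v guv; have [[m [um _ ->]]|[_ ->]] := yP u.
    by rewrite -exprS yL // (LS _ u).
  rewrite mulr0; have [[m [_ _ ->]]|[_ ->//]] := yP v.
  by rewrite exprn_ge0 // ltW.
move=> v vS; have [[n [vn nmin ->]]|[_ ->]] := yP v; last by rewrite ltxx.
move=> _; case: n vn nmin => [|n] vn nmin; first by rewrite vn in vS.
move: (vn); rewrite /= inE => /exists_inP[u un guv]; exists u => //.
have [[m [um mmin ->]]|[/(_ n)]] := yP u; last by rewrite un.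
have -> : m = n; last by rewrite exprS.
by apply/eqP; rewrite eqn_leq mmin //= -ltnS nmin // (LS _ u).
Qed.

(** Joints on a common edge differ by at most one level, which puts their weights between [q * m e]
    and [m e]. The last clause provides the edge through which a joint is reached from [S]. *)
Lemma core_levels (R : realType) (V : finType) (F : {set {set V}}) (S : {set V})
    (q : R) : 0 < q -> q <= 1 -> is_core F -> S \subset joints F ->
  exists y : V -> R, exists m : {set V} -> R,
    [/\ forall v, 0 <= y v, forall e, 0 <= m e, {in S, forall v, y v = 1} &
    [/\ {in F, forall e, {in e :&: joints F, forall v, q * m e <= y v <= m e}},
        {in F, forall e, exists2 u, u \in e :&: joints F & y u = m e} &
        {in joints F, forall v, v \notin S -> 0 < y v ->
          exists2 e, e \in F & v \in e /\ y v <= q * m e}]].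
Proof.
move=> q0 q1 /coreP Fcore SJ.
pose g : rel V := fun u v => [exists e in F,
  (u \in e :&: joints F) && (v \in e :&: joints F)].
have [y [y0 yS yg ylev]] := geometric_levels g S q0 q1.
(* The default 0 does not disturb the maximum of nonnegative weights; on edges of [F] it is
   attained, because a core edge has joints. *)
pose m (e : {set V}) := \big[Order.max/0]_(u in e :&: joints F) y u.
have ym e v : v \in e :&: joints F -> y v <= m e.
  by move=> ve; apply: le_bigmax_cond.
have my e : e \in F -> exists2 u, u \in e :&: joints F & y u = m e.
  move=> eF; have /card_gt0P[u0 u0e] : (0 < #|e :&: joints F|)%N.
    by apply: ltnW; apply: Fcore.
  have [u ue mu] := eq_bigmax u0 (mem (e :&: joints F)) y u0e (fun v _ => y0 v).
  by exists u.
exists y, m; split => //.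
  by move=> e; apply: bigmax_ge_id.
split => // [e eF v ve|v vJ vS yv].
  rewrite ym // andbT; have [u ue <-] := my e eF; apply: yg.
  by apply/exists_inP; exists e; rewrite // ue.
have [u /exists_inP[e eF /andP[ue ve]] ->] := ylev v vS yv.
exists e => //; split; first by move: ve; rewrite in_setI => /andP[].
by rewrite ler_wpM2l ?ym // ltW.
Qed.

(** The solution b of the linear relation b = (1 - b)(1 - a). *)
Definition beta_star (R : realType) : R := (1 - alpha_star R) / (2 - alpha_star R).

(** 27/125 is the cube of 3/5, the weight of the special edge in [alpha_lt_of_triple_edge]. *)
Lemma alpha_star_bounds (R : realType) : 27 / 125 < alpha_star R < 1 / 4.
Proof.
have [/andP[a0 a1] aE] := (alpha_starP (alpha_star R)).2 erefl.
move: (alpha_star R) a0 a1 aE => a a0 a1 aE; apply/andP; split.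
  rewrite ltNge; apply/negP => h; have : (98/125) ^+ 5 <= (1 - a) ^+ 5.
    by rewrite lerXn2r // ?nnegrE; lra.
  by rewrite aE; lra.
rewrite ltNge; apply/negP => h; have : (1 - a) ^+ 5 <= (3 / 4) ^+ 5.
  by rewrite lerXn2r // ?nnegrE; lra.
by rewrite aE; lra.
Qed.

Lemma alpha_star_cubic (R : realType) :
  let a := alpha_star R in 1 - 5 * a + 4 * a ^+ 2 - a ^+ 3 = 0.
Proof.
have /andP[a0 a1] := alpha_star_bounds R.
have [_ aE] := (alpha_starP (alpha_star R)).2 erefl.
move: (alpha_star R) a0 a1 aE => a a0 a1 aE /=.
have E : (1 - 5 * a + 4 * a ^+ 2 - a ^+ 3) * (1 - a + a ^+ 2) = (1 - a) ^+ 5 - a.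
  by ring.
move/eqP: E; rewrite aE subrr mulf_eq0 => /orP[/eqP //|/eqP].
by have := sqr_ge0 a; move: (a ^+ 2) => s; lra.
Qed.

Lemma beta_starE (R : realType) :
  beta_star R = (1 - beta_star R) * (1 - alpha_star R).
Proof.
have /andP[a0 a1] := alpha_star_bounds R; rewrite /beta_star; field.
by apply/eqP; lra.
Qed.

(** This is where the value of [alpha_star] matters: for b = (1 - a)/(2 - a) the equation b (1 - b)
    = a is the cubic equation of a with denominators cleared. *)
Lemma beta_star_prod (R : realType) :
  beta_star R * (1 - beta_star R) = alpha_star R.
Proof.
have /andP[a0 a1] := alpha_star_bounds R; have := alpha_star_cubic R.
rewrite /= /beta_star; move: (alpha_star R) a0 a1 => a a0 a1 cub.
have a2 : 2 - a != 0 by apply/eqP; lra.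
apply/eqP; rewrite -subr_eq0; apply/eqP.
transitivity ((1 - 5 * a + 4 * a ^+ 2 - a ^+ 3) / (2 - a) ^+ 2).
  by field.
by rewrite cub mul0r.
Qed.

(** Above 2/5, b completes the weight 3/5 to more than 1; below 1/2, it satisfies b < 1 - b. *)
Lemma beta_star_bounds (R : realType) : 2 / 5 < beta_star R < 1 / 2.
Proof.
have /andP[a0 a1] := alpha_star_bounds R; rewrite /beta_star.
by rewrite ltr_pdivlMr ?ltr_pdivrMr; try (apply/andP; split); lra.
Qed.

Lemma prod_levels_ge (R : realType) (V : finType) (A : {set V}) (y : V -> R)
    (q m : R) (u : V) : 0 <= q -> 0 <= m ->
    {in A, forall v, q * m <= y v} -> u \in A -> y u = m ->
  m ^+ #|A| * q ^+ #|A|.-1 <= \prod_(v in A) y v.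
Proof.
move=> q0 m0 ym uA yu; rewrite (cardsD1 u) uA add1n /= exprS -mulrA.
rewrite (big_setD1 u) //= yu ler_wpM2l // mulrC -exprMn -prodr_const.
by apply: ler_prod => v; rewrite !inE => /andP[_ /ym ->]; rewrite mulr_ge0.
Qed.

(** Replace all but one factor b by (1 - b)(1 - a) and use b (1 - b) = a. Equality holds for s = 2,
    an edge with two joints. *)
Lemma beta_star_pow (R : realType) (s : nat) : (1 < s)%N ->
  beta_star R ^+ s <= alpha_star R * (1 - alpha_star R) ^+ s.-1.
Proof.
have /andP[b0 b1] := beta_star_bounds R; have /andP[a0 a1] := alpha_star_bounds R.
case: s => [|[|s]] //= _; rewrite exprS {2}beta_starE exprMn mulrA.
rewrite ler_wpM2r ?exprn_ge0 //; first by lra.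
rewrite -beta_star_prod ler_wpM2l //; first by lra.
by rewrite exprS ler_piMr ?exprn_ile1; lra.
Qed.

Lemma level_edge (R : realType) (V : finType) (A : {set V}) (y : V -> R)
    (m : R) (u : V) : (1 < #|A|)%N -> 0 <= m ->
    {in A, forall v, (1 - alpha_star R) * m <= y v} -> u \in A -> y u = m ->
  (beta_star R * m) ^+ #|A| <= alpha_star R * \prod_(v in A) y v.
Proof.
move=> A1 m0 ym uA yu; have /andP[a0 a1] := alpha_star_bounds R.
have q0 : 0 <= 1 - alpha_star R by lra.
have := prod_levels_ge q0 m0 ym uA yu.
rewrite exprMn => /(ler_wpM2l (ltW (lt_trans _ a0))) h.
apply: le_trans (h _); last by lra.
by rewrite mulrCA [leRHS]mulrC ler_wpM2r ?exprn_ge0 // beta_star_pow.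
Qed.

(** An edge whose joints all lie on one level has room to spare, because b^2 < b (1 - b) = a. *)
Lemma level_edge_lt (R : realType) (V : finType) (A : {set V}) (y : V -> R)
    (m : R) : (1 < #|A|)%N -> 0 < m -> {in A, forall v, m <= y v} ->
  (beta_star R * m) ^+ #|A| < alpha_star R * \prod_(v in A) y v.
Proof.
move=> A1 m0 ym; have /andP[a0 a1] := alpha_star_bounds R.
have /andP[b0 b1] := beta_star_bounds R.
apply: (@lt_le_trans _ _ (alpha_star R * m ^+ #|A|)); last first.
  rewrite ler_wpM2l //; first by lra.
  by rewrite -prodr_const ler_prod // => v vA; rewrite ltW //= ym.
rewrite exprMn ltr_pM2r ?exprn_gt0 // -beta_star_prod.
case: #|A| A1 => [|[|s]] // _; rewrite exprS ltr_pM2l; last by lra.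
rewrite exprS; apply: (@le_lt_trans _ _ (beta_star R)); last by lra.
by rewrite ler_piMr ?exprn_ile1; lra.
Qed.

Lemma sum_edges_ge2 (R : realType) (V : finType) (G : {set {set V}})
    (c : {set V} -> R) (v : V) (e f : {set V}) :
    (forall e, 0 <= c e) -> e \in G -> f \in G -> v \in e -> v \in f -> f != e ->
  c e + c f <= \sum_(e in G | v \in e) c e.
Proof.
move=> c0 eG fG ve vf fe; rewrite (bigD1 e) /= ?eG //.
rewrite (bigD1 f) /= ?fG ?vf // addrA lerDl.
by apply: sumr_ge0.
Qed.

Lemma sum_edges_ge3 (R : realType) (V : finType) (G : {set {set V}})
    (c : {set V} -> R) (v : V) (e f g : {set V}) :
    (forall e, 0 <= c e) -> e \in G -> f \in G -> g \in G ->
    v \in e -> v \in f -> v \in g -> f != e -> g != e -> g != f ->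
  c e + c f + c g <= \sum_(e in G | v \in e) c e.
Proof.
move=> c0 eG fG gG ve vf vg fe ge gf; rewrite (bigD1 e) /= ?eG //.
rewrite (bigD1 f) /= ?fG ?vf // (bigD1 g) /= ?gG ?vg ?ge // !addrA lerDl.
by apply: sumr_ge0.
Qed.

(** [c] need only dominate b m on [F], and [G] may be larger than [F], so that a special edge may
    weigh more and a pendant edge may be added. *)
Lemma level_vertex (R : realType) (V : finType) (F G : {set {set V}})
    (S : {set V}) (y : V -> R) (m c : {set V} -> R) (v : V) :
    F \subset G -> (forall e, 0 <= c e) ->
    {in F, forall e, beta_star R * m e <= c e} ->
    {in F, forall e, {in e :&: joints F, forall v, y v <= m e}} ->
    {in joints F, forall v, v \notin S -> 0 < y v ->
      exists2 e, e \in F & v \in e /\ y v <= (1 - alpha_star R) * m e} ->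
    v \in joints F -> v \notin S ->
  y v <= \sum_(e in G | v \in e) c e.
Proof.
move=> /subsetP FG c0 cm ym ylev vJ vS; have /andP[b0 b1] := beta_star_bounds R.
have [yv|yv] := lerP (y v) 0; first by apply: le_trans yv _; exact: sumr_ge0.
have [e eF [ve ye]] := ylev v vJ vS yv.
have [f [fF vf fe]] := joint_other_edge e vJ.
apply: le_trans (sum_edges_ge2 c0 (FG e eF) (FG f fF) ve vf fe).
have yf : y v <= m f by apply: ym => //; rewrite in_setI vf.
have /(ler_wpM2l (ltW (lt_trans _ b0))) h1 := yf.
have b1_ge0 : 0 <= 1 - beta_star R by lra.
have := ler_wpM2l b1_ge0 ye; rewrite mulrA -beta_starE => h2.
by have := cm e eF; have := cm f fF; have := h1 ltac:(lra); lra.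
Qed.

(** * Cores with a special place *)

(** With [p] as the place, each of three edges at [p] weighs at least b, and 3b > 1 leaves slack at
    [p]. *)
Lemma alpha_lt_of_triple_joint (R : realType) (k : nat) (V : finType)
    (H : kgraph k V) (F : {set {set V}}) (p : V) :
    (1 < k)%N -> F \subset edges H -> is_core F ->
    (2 < #|[set e in F | p \in e]|)%N ->
  alpha R H < alpha_star R.
Proof.
move=> k1 FH Fcore p3; have /andP[a0 a1] := alpha_star_bounds R.
have /andP[b0 b1] := beta_star_bounds R.
have pJ : p \in joints F by rewrite inE ltnW.
have q0 : 0 < 1 - alpha_star R by lra.
have q1 : 1 - alpha_star R <= 1 by lra.
have SJ : [set p] \subset joints F by rewrite sub1set.
have [y [m [y0 m0 yS [ym my ylev]]]] := core_levels q0 q1 Fcore SJ.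
have y1 : y p = 1 by apply: yS; rewrite set11.
have ym' : {in F, forall e, {in e :&: joints F, forall v, y v <= m e}}.
  by move=> e eF v ve; have /andP[] := ym e eF v ve.
have c0 e : 0 <= beta_star R * m e by rewrite mulr_ge0 //; lra.
have sum_p : y p < \sum_(e in F | p \in e) beta_star R * m e.
  have [e [f [g]]] := card_gt2P p3.
  rewrite !inE => -[[/andP[eF pe] /andP[fF pf] /andP[gF pg]] [ef fg ge]].
  have m1 h : h \in F -> p \in h -> 1 <= m h.
    by move=> hF ph; rewrite -y1 ym' // in_setI ph.
  apply: lt_le_trans (sum_edges_ge3 c0 eF fF gF pe pf pg _ ge _); last first.
  - by rewrite eq_sym.
  - by rewrite eq_sym.
  rewrite y1; have := m1 e eF pe; have := m1 f fF pf; have := m1 g gF pg; nra.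
apply: (@alpha_lt_joints _ _ _ _ _ F (joints F) y (fun e => beta_star R * m e))
  => //; first by lra.
- by move=> v e f; apply: not_joint_uniq.
- move=> e eF; have [u ue yu] := my e eF.
  apply: (level_edge _ _ _ ue) => //; first exact: (coreP _ Fcore).
  by move=> v ve; have /andP[] := ym e eF v ve.
- move=> v vJ; have [->|vp] := eqVneq v p; first exact: ltW.
  by apply: (level_vertex (m := m) (F := F) (S := [set p])); rewrite // inE.
by left; exists p.
Qed.

Lemma alpha_lt_of_triple_edge (R : realType) (k : nat) (V : finType)
    (H : kgraph k V) (F : {set {set V}}) (p : {set V}) :
    (1 < k)%N -> F \subset edges H -> is_core F -> p \in F ->
    (2 < #|p :&: joints F|)%N ->
  alpha R H < alpha_star R.
Proof.
move=> k1 FH Fcore pF p3; have /andP[a0 a1] := alpha_star_bounds R.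
have /andP[b0 b1] := beta_star_bounds R.
have q0 : 0 < 1 - alpha_star R by lra.
have q1 : 1 - alpha_star R <= 1 by lra.
have SJ : p :&: joints F \subset joints F by apply: subsetIr.
have [y [m [y0 m0 yS [ym my ylev]]]] := core_levels q0 q1 Fcore SJ.
have ym' : {in F, forall e, {in e :&: joints F, forall v, y v <= m e}}.
  by move=> e eF v ve; have /andP[] := ym e eF v ve.
have mp : m p = 1 by have [u ue <-] := my p pF; apply: yS.
(* All joints of [p] have weight 1. With at least three of them the edge condition at [p] follows
   from (3/5)^3 < a, and each receives at least 3/5 + b > 1. *)
pose c (e : {set V}) : R := if e == p then 3 / 5 else beta_star R * m e.
have c0 e : 0 <= c e by rewrite /c; case: ifP => _; [|rewrite mulr_ge0 //]; lra.
have sum_p v : v \in p :&: joints F -> y v < \sum_(e in F | v \in e) c e.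
  move=> vS; move: (vS); rewrite in_setI => /andP[vp vJ].
  have [f [fF vf fp]] := joint_other_edge p vJ.
  apply: lt_le_trans (sum_edges_ge2 c0 pF fF vp vf fp).
  have : y v <= m f by apply: ym' => //; rewrite in_setI vf.
  by rewrite (yS v vS) /c eqxx (negPf fp); nra.
apply: (@alpha_lt_joints _ _ _ _ _ F (joints F) y c) => //; first by lra.
- by move=> v e f; apply: not_joint_uniq.
- move=> e eF; rewrite /c; case: eqP => [->|_].
    rewrite big1 => [|v]; last exact: yS.
    case: #|_| p3 => [|[|[|s]]] // _; rewrite !exprS.
    have : (3 / 5 : R) ^+ s <= 1 by rewrite exprn_ile1; lra.
    by lra.
  have [u ue yu] := my e eF.
  apply: (level_edge _ _ _ ue) => //; first exact: (coreP _ Fcore).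
  by move=> v ve; have /andP[] := ym e eF v ve.
- move=> v vJ; have [/sum_p/ltW//|vp] := boolP (v \in p :&: joints F).
  apply: (level_vertex (m := m) (F := F) (S := p :&: joints F)) => // e _.
  by rewrite /c; case: eqP => [->|//]; rewrite mp; lra.
left; have /card_gt0P[v vS] : (0 < #|p :&: joints F|)%N by apply: ltn_trans p3.
by exists v; rewrite ?(subsetP SJ v vS) ?sum_p.
Qed.

Lemma alpha_lt_of_pendant_joint (R : realType) (k : nat) (V : finType)
    (H : kgraph k V) (F : {set {set V}}) (f : {set V}) (p : V) :
    (1 < k)%N -> F \subset edges H -> is_core F -> f \in edges H ->
    f :&: cover F = [set p] -> p \in joints F ->
  alpha R H < alpha_star R.
Proof.
move=> k1 FH Fcore fH fp pJ; have /andP[a0 a1] := alpha_star_bounds R.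
have /andP[b0 b1] := beta_star_bounds R.
have q0 : 0 < 1 - alpha_star R by lra.
have q1 : 1 - alpha_star R <= 1 by lra.
have SJ : [set p] \subset joints F by rewrite sub1set.
have [y [m [y0 m0 yS [ym my ylev]]]] := core_levels q0 q1 Fcore SJ.
have y1 : y p = 1 by apply: yS; rewrite set11.
have ym' : {in F, forall e, {in e :&: joints F, forall v, y v <= m e}}.
  by move=> e eF v ve; have /andP[] := ym e eF v ve.
have inF e v : e \in F -> v \in e -> v \in f -> v = p.
  move=> eF ve vf; apply/set1P; rewrite -fp in_setI vf.
  by apply/bigcupP; exists e.
have fF : f \notin F.
  apply/negP => /[dup] fF /(coreP _ Fcore); rewrite ltnNge => /negP; apply.
  rewrite -(cards1 p) subset_leq_card //; apply/subsetP => v.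
  by rewrite in_setI inE => /andP[vf _]; rewrite (inF f v).
have neqf e : e \in F -> e != f by move=> eF; apply: contraNneq fF => <-.
have fJ : f :&: joints F = [set p].
  apply/eqP; rewrite eqEsubset -{1}fp setIS ?joints_cover //= sub1set in_setI pJ.
  by have := set11 p; rewrite -fp in_setI => /andP[->].
have pf : p \in f by have := set11 p; rewrite -fp in_setI => /andP[].
(* The only joint on [f] is [p], of weight 1, so the edge condition at [f] is tight. The vertex [p]
   receives at least a + 2b > 1. *)
pose c (e : {set V}) : R := if e == f then alpha_star R else beta_star R * m e.
have c0 e : 0 <= c e by rewrite /c; case: ifP => _; [|rewrite mulr_ge0 //]; lra.
have cF e : e \in F -> c e = beta_star R * m e.
  by rewrite /c => /neqf/negPf ->.
have FG : F \subset f |: F by apply: subsetUr.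
have sum_p : y p < \sum_(e in f |: F | p \in e) c e.
  have /jointP[e [g [eF gF pe pg eg]]] := pJ.
  have m1 h : h \in F -> p \in h -> 1 <= m h.
    by move=> hF ph; rewrite -y1 ym' // in_setI ph.
  have efg := sum_edges_ge3 c0 (setU11 f F) (setU1r f eF) (setU1r f gF) pf pe pg
    (neqf e eF) (neqf g gF).
  apply: lt_le_trans (efg _); last by rewrite eq_sym.
  rewrite y1 (cF e) // (cF g) // {1}/c eqxx.
  by have := m1 e eF pe; have := m1 g gF pg; nra.
apply: (@alpha_lt_joints _ _ _ _ _ (f |: F) (joints F) y c) => //.
- by lra.
- by rewrite subUset sub1set fH.
- move=> v e g vJ /setU1P[->|eF] /setU1P[->|gF] // ve vg.
  + by rewrite (inF g v) // pJ in vJ.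
  + by rewrite (inF e v) // pJ in vJ.
  + exact: (not_joint_uniq vJ).
- move=> e /setU1P[->|eF].
    by rewrite fJ cards1 big_set1 y1 mulr1 expr1 /c eqxx.
  rewrite cF //; have [u ue yu] := my e eF.
  apply: (level_edge _ _ _ ue) => //; first exact: (coreP _ Fcore).
  by move=> v ve; have /andP[] := ym e eF v ve.
- move=> v vJ; have [->|vp] := eqVneq v p; first exact: ltW.
  apply: (level_vertex (m := m) (F := F) (S := [set p])); rewrite ?in_set1 //.
  by move=> e eF; rewrite cF.
by left; exists p.
Qed.

(* This case is sharp: for long cycles the only slack is at the vertices that are
   farthest from [e0]. *)
Lemma alpha_lt_of_pendant_edge (R : realType) (k : nat) (V : finType)
    (H : kgraph k V) (F : {set {set V}}) (f e0 : {set V}) (p : V) :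
    (1 < k)%N -> F \subset edges H -> is_core F -> f \in edges H ->
    f :&: cover F = [set p] -> e0 \in F -> p \in e0 -> p \notin joints F ->
  alpha R H < alpha_star R.
Proof.
move=> k1 FH Fcore fH fp e0F pe0 pJ; have /andP[a0 a1] := alpha_star_bounds R.
have /andP[b0 b1] := beta_star_bounds R.
have q0 : 0 < 1 - alpha_star R by lra.
have q1 : 1 - alpha_star R <= 1 by lra.
set S := e0 :&: joints F.
have SJ : S \subset joints F by apply: subsetIr.
have [y [m [y0 m0 yS [ym my ylev]]]] := core_levels q0 q1 Fcore SJ.
have ym' : {in F, forall e, {in e :&: joints F, forall v, y v <= m e}}.
  by move=> e eF v ve; have /andP[] := ym e eF v ve.
have me0 : m e0 = 1 by have [u ue <-] := my e0 e0F; apply: yS.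
have inF e v : e \in F -> v \in e -> v \in f -> v = p.
  move=> eF ve vf; apply/set1P; rewrite -fp in_setI vf.
  by apply/bigcupP; exists e.
have fF : f \notin F.
  apply/negP => /[dup] fF /(coreP _ Fcore); rewrite ltnNge => /negP; apply.
  rewrite -(cards1 p) subset_leq_card //; apply/subsetP => v.
  by rewrite in_setI inE => /andP[vf _]; rewrite (inF f v).
have neqf e : e \in F -> e != f by move=> eF; apply: contraNneq fF => <-.
have pf : p \in f by have := set11 p; rewrite -fp in_setI => /andP[].
(* Attaching [f] turns [p] into a joint. *)
pose J := p |: joints F.
have fJ : f :&: J = [set p].
  apply/setP => v; rewrite in_setI in_setU1 in_set1.
  have [->|vp] := eqVneq v p; first by rewrite pf.
  apply/negP => /andP[vf /= /jointP[e [_ [eF _ ve _ _]]]].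
  by rewrite (inF e v) // eqxx in vp.
have eJ e : e \in F -> e != e0 -> e :&: J = e :&: joints F.
  move=> eF ee0; apply/setP => v; rewrite !in_setI in_setU1.
  have [->|//] := eqVneq v p; rewrite (negPf pJ) andbF andbT.
  apply/negP => pe; case/eqP: ee0; exact: (not_joint_uniq pJ).
have e0J : e0 :&: J = p |: S.
  by rewrite /J setIUr (setIidPr _) ?sub1set.
have pS : p \notin S by rewrite in_setI (negPf pJ) andbF.
(* The weight [wp] of [p] makes the vertex condition tight: a wp comes from [f] and 1 - b from [e0].
   Moreover a wp = (1 - b)^3, so the edge condition at [e0] is tight when [e0] has two joints in
   [F]. *)
pose wp : R := (1 - beta_star R) / (1 - alpha_star R).
have wpE : wp * (1 - alpha_star R) = 1 - beta_star R.
  by rewrite /wp mulfVK // gt_eqF.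
have wp0 : 0 <= wp by rewrite /wp divr_ge0 //; lra.
pose y' v : R := if v == p then wp else y v.
pose c (e : {set V}) : R := if e == f then alpha_star R * wp else
  if e == e0 then 1 - beta_star R else beta_star R * m e.
have c0 e : 0 <= c e.
  rewrite /c; case: ifP => _; first by rewrite mulr_ge0 //; lra.
  by case: ifP => _; [lra|rewrite mulr_ge0 //; lra].
have ce0 : c e0 = 1 - beta_star R by rewrite /c (negPf (neqf _ e0F)) eqxx.
have cf : c f = alpha_star R * wp by rewrite /c eqxx.
have cF e : e \in F -> e != e0 -> c e = beta_star R * m e.
  by rewrite /c => /neqf/negPf -> /negPf ->.
have FG : F \subset f |: F by apply: subsetUr.
have y'E v : v \in joints F -> y' v = y v.
  by move=> vJ; rewrite /y'; case: eqP => // vp; rewrite -vp vJ in pJ.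
have y'prod (A : {set V}) : A \subset joints F ->
    \prod_(v in A) y' v = \prod_(v in A) y v.
  by move=> /subsetP AJ; apply: eq_bigr => v /AJ/y'E.
have other v : v \in joints F -> 0 < y v ->
    exists e g, [/\ e \in F, g \in F, v \in e, v \in g & g != e] /\
      [/\ g != e0 & (1 - beta_star R) * y v <= c e].
  move=> vJ yv; have [vS|vS] := boolP (v \in S).
    have [g [gF vg ge0]] := joint_other_edge e0 vJ.
    exists e0, g; split; split => //; first by move: vS; rewrite in_setI => /andP[].
    by rewrite ce0 yS // mulr1.
  have [e eF [ve ye]] := ylev v vJ vS yv.
  have ne0 (h : {set V}) : v \in h -> h != e0.
    by move=> vh; apply: contraNneq vS => he; rewrite /S in_setI -he vh.
  have [g [gF vg ge]] := joint_other_edge e vJ.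
  exists e, g; split; split; rewrite ?ne0 //.
  rewrite cF ?ne0 // {2}beta_starE -mulrA ler_wpM2l //; first by lra.
apply: (@alpha_lt_joints _ _ _ _ _ (f |: F) J y' c) => //.
- by lra.
- by rewrite subUset sub1set fH.
- by move=> v; rewrite /y'; case: ifP.
- move=> v e g; rewrite in_setU1 negb_or => /andP[vp vJ].
  move=> /setU1P[->|eF] /setU1P[->|gF] // ve vg.
  + by rewrite (inF g v) // eqxx in vp.
  + by rewrite (inF e v) // eqxx in vp.
  + exact: (not_joint_uniq vJ).
- move=> e /setU1P[->|eF].
    by rewrite fJ cards1 big_set1 /y' eqxx expr1 cf.
  have [->|ee0] := eqVneq e e0.
    rewrite e0J cardsU1 pS add1n big_setU1 //= {1}/y' eqxx y'prod //.
    rewrite [\prod_(v in S) y v]big1 => [|v]; last exact: yS.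
    have : (1 < #|S|)%N by apply: (coreP _ Fcore).
    rewrite ce0 mulr1; case: #|S| => [|[|s]] // _.
    have -> : alpha_star R * wp = (1 - beta_star R) ^+ 3.
      rewrite -{1}beta_star_prod {1}beta_starE -mulrA mulrC -mulrA -wpE; ring.
    rewrite -(addn3 s) exprD -[leRHS]mul1r ler_wpM2r ?exprn_ge0 //; first by lra.
    by rewrite exprn_ile1 //; lra.
  rewrite eJ // cF // y'prod ?subsetIr //; have [u ue yu] := my e eF.
  apply: (level_edge _ _ _ ue) => //; first exact: (coreP _ Fcore).
  by move=> v ve; have /andP[] := ym e eF v ve.
- move=> v; rewrite in_setU1 => /orP[/eqP ->|vJ].
    have := sum_edges_ge2 c0 (setU11 f F) (setU1r f e0F) pf pe0 (neqf _ e0F).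
    by apply: le_trans; rewrite /y' eqxx cf ce0; have := wpE; lra.
  rewrite y'E //; have [yv|yv] := lerP (y v) 0.
    by apply: le_trans yv _; exact: sumr_ge0.
  have [e [g [[eF gF ve vg ge] [ge0 ye]]]] := other v vJ yv.
  apply: le_trans (sum_edges_ge2 c0 (subsetP FG e eF) (subsetP FG g gF) ve vg ge).
  have : y v <= m g by apply: ym' => //; rewrite in_setI vg.
  by rewrite (cF g) //; nra.
(* Strictness is sought at a joint [v] of least positive weight. Either its second edge [g] carries
   a larger weight, and [v] has slack, or all joints on [g] weigh at least [m g], and [g] has
   slack. *)
have /card_gt0P[v0 v0S] : (0 < #|S|)%N by apply: ltnW; apply: (coreP _ Fcore).
pose P v := (v \in joints F) && (0 < y v).
have Pv0 : P v0 by rewrite /P (subsetP SJ v0 v0S) yS // ltr01.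
case: (arg_minP y Pv0) => v /andP[vJ yv] vmin.
have [e [g [[eF gF ve vg ge] [ge0 ye]]]] := other v vJ yv.
have yg : y v <= m g by apply: ym' => //; rewrite in_setI vg.
have [ygl|ygg] := ltrP (y v) (m g).
  left; exists v; first by rewrite in_setU1 vJ orbT.
  rewrite y'E //.
  apply: lt_le_trans (sum_edges_ge2 c0 (subsetP FG e eF) (subsetP FG g gF) ve vg ge).
  by rewrite (cF g) //; nra.
have mg : 0 < m g by apply: lt_le_trans yg.
right; exists g; first exact: setU1r.
rewrite eJ // cF // y'prod ?subsetIr //; split; first by rewrite mulr_gt0 //; lra.
apply: level_edge_lt => //; first exact: (coreP _ Fcore).
move=> u ug; apply: le_trans ygg _; apply: vmin.
rewrite /P; move: (ug); rewrite in_setI => /andP[_ ->] /=.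
have /andP[yu _] := ym g gF u ug; apply: lt_le_trans yu; exact: mulr_gt0.
Qed.

(** * Regular connected hypergraphs are loose cycles *)

(* The composition of two fixed-point-free involutions acts on each of its cycles
   as a rotation of which neither involution is a power: such a power would lead,
   halfway, to a fixed point. *)
Lemma iter_involutions_neq (T : Type) (D : pred T) (rho tau : T -> T) :
    (forall d, D d -> [/\ D (rho d), rho (rho d) = d & rho d <> d]) ->
    (forall d, D d -> [/\ D (tau d), tau (tau d) = d & tau d <> d]) ->
  forall n d, D d ->
    iter n (tau \o rho) d <> tau d /\ iter n (tau \o rho) d <> rho d.
Proof.
move=> rhoP tauP; pose s := tau \o rho.
have sD n d : D d -> D (iter n s d).
  elim: n => //= n IH /IH Dn.
  by have [/tauP[]] := rhoP _ Dn.
have tauN n d : D d -> iter n s d <> tau d.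
  have [m] := ubnP n; elim: m => // m IH in n d *; case: n => [|[|n]] nm Dd.
  - by have [_ _ h] := tauP _ Dd => /esym.
  - have [Drd rK rN] := rhoP _ Dd; have [_ tK _] := tauP _ Dd.
    have [_ trK _] := tauP _ Drd => /(congr1 tau) /=.
    by rewrite trK tK.
  have [Drd rK rN] := rhoP _ Dd; have [_ tK _] := tauP _ Dd.
  have [Dsd trK _] := tauP _ Drd.
  (* Cancelling one [tau] and one [rho] in s^(n+2) d = tau d leaves s^n (s d) = rho d = tau (s d),
     two steps shorter. *)
  rewrite iterS iterSr => h; apply: (IH n (s d)) => //; first by lia.
  have Di := sD n _ Dsd; have [Dri riK _] := rhoP _ Di; have [_ triK _] := tauP _ Dri.
  move: h => /= /(congr1 tau); rewrite triK tK => /(congr1 rho); rewrite riK => ->.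
  by rewrite trK.
move=> n d Dd; split; first exact: tauN.
have [Drd rK rN] := rhoP _ Dd; have [Dsd trK _] := tauP _ Drd.
case: n => [/esym //|n]; rewrite iterSr => h; apply: (tauN n _ Dsd).
by rewrite h trK.
Qed.

Lemma card2_other (T : finType) (A : {set T}) (x : T) : #|A| = 2%N -> x \in A ->
  exists y, A = [set x; y] /\ y != x.
Proof.
move=> /eqP/cards2P[a [b [ab ->]]]; rewrite in_set2 => /orP[/eqP ->|/eqP ->].
  by exists b; rewrite eq_sym.
by exists a; rewrite setUC.
Qed.

(** On the flags (joint, edge), [rho] switches the joint within the edge and [tau] the edge at the
    joint; tau after rho walks around the cycle. Two flags of one orbit sharing a joint or an edge
    coincide, as [tau] and [rho] leave the orbit; connectedness makes the orbit exhaust [H]. *)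
Lemma loose_cycle_of_regular (k : nat) (V : finType) (H : kgraph k V) :
    (2 <= k)%N -> kgraph_connected H -> edges H != set0 ->
    {in edges H, forall e, #|e :&: joints (edges H)| = 2%N} ->
    (forall v, (#|[set e in edges H | v \in e]| <= 2)%N) ->
  is_loose_cycle H.
Proof.
move=> k2 [V0 conn] E0 e2 v2; set E := edges H; set J := joints E.
pose D (d : V * {set V}) := [&& d.2 \in E, d.1 \in d.2 & d.1 \in J].
have /choice[ov ovP] : forall d, exists u : V,
    D d -> d.2 :&: J = [set d.1; u] /\ u != d.1.
  move=> d; have [/and3P[dE dd dJ]|_] := boolP (D d); last by exists d.1.
  have [|u [h1 h2]] := card2_other (x := d.1) (e2 _ dE); first by rewrite in_setI dd.
  by exists u.
have /choice[oe oeP] : forall d : V * {set V}, exists f : {set V},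
    D d -> [set e in E | d.1 \in e] = [set d.2; f] /\ f != d.2.
  move=> d; have [/and3P[dE dd dJ]|_] := boolP (D d); last by exists d.2.
  have c2 : #|[set e in E | d.1 \in e]| = 2%N.
    by apply/eqP; rewrite eqn_leq v2; move: dJ; rewrite inE.
  have [|f [h1 h2]] := card2_other (x := d.2) c2; first by rewrite inE dE.
  by exists f.
pose rho d := (ov d, d.2); pose tau d := (d.1, oe d).
have rhoD d : D d -> D (rho d).
  move=> Dd; have [h _] := ovP _ Dd; have := set22 d.1 (ov d).
  by rewrite -h in_setI => /andP[h1 h2]; rewrite /D /= h1 h2; case/and3P: Dd => ->.
have tauD d : D d -> D (tau d).
  move=> Dd; have [h _] := oeP _ Dd; have := set22 d.2 (oe d).
  by rewrite -h inE => /andP[h1 h2]; rewrite /D /= h1 h2; case/and3P: Dd.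
have rhoE d d' : D d -> D d' -> d.2 = d'.2 -> d' = d \/ d' = rho d.
  move=> Dd /and3P[_ h1 h2] dd'; have [h _] := ovP _ Dd.
  have : d'.1 \in [set d.1; ov d] by rewrite -h in_setI dd' h1.
  rewrite in_set2 => /orP[] /eqP h'; [left|right].
    by rewrite [d']surjective_pairing -dd' h' -surjective_pairing.
  by rewrite [d']surjective_pairing -dd' h'.
have tauE d d' : D d -> D d' -> d.1 = d'.1 -> d' = d \/ d' = tau d.
  move=> Dd /and3P[h1 h2 _] dd'; have [h _] := oeP _ Dd.
  have : d'.2 \in [set d.2; oe d] by rewrite -h inE dd' h1.
  rewrite in_set2 => /orP[] /eqP h'; [left|right].
    by rewrite [d']surjective_pairing -dd' h' -surjective_pairing.
  by rewrite [d']surjective_pairing -dd' h'.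
have rhoP d : D d -> [/\ D (rho d), rho (rho d) = d & rho d <> d].
  move=> Dd; have [_ h] := ovP _ Dd; have Drd := rhoD _ Dd; split => //.
    have [h'|//] := rhoE _ _ Drd Dd erefl.
    by move: h; rewrite {2}h' /= eqxx.
  by move=> /(congr1 fst) /= /eqP; rewrite (negPf h).
have tauP d : D d -> [/\ D (tau d), tau (tau d) = d & tau d <> d].
  move=> Dd; have [_ h] := oeP _ Dd; have Dtd := tauD _ Dd; split => //.
    have [h'|//] := tauE _ _ Dtd Dd erefl.
    by move: h; rewrite {2}h' /= eqxx.
  by move=> /(congr1 snd) /= /eqP; rewrite (negPf h).
have neq := iter_involutions_neq rhoP tauP.
pose s := tau \o rho.
have sD d : D d -> D (s d) by move=> Dd; apply: tauD; apply: rhoD.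
have s_inj : {in [pred d | D d] &, injective s}.
  move=> d d' Dd Dd' /= h; have [Drd rK _] := rhoP _ Dd.
  have [Drd' rK' _] := rhoP _ Dd';
    have [_ tK _] := tauP _ Drd; have [_ tK' _] := tauP _ Drd'.
  by rewrite -rK -rK' -tK -tK'; congr (rho (tau _)); exact: h.
have [d0 D0] : exists d, D d.
  have /set0Pn[e eE] := E0; have := e2 e eE => /eqP/cards2P[u [w [_ h]]].
  exists (u, e); have := set21 u w; rewrite -h in_setI /D /= eE.
  by move=> /andP[-> ->].
pose n := order s d0; pose x i := iter i s d0.
have xD i : D (x i) by elim: i => //= i; apply: sD.
have xn : x n = x 0%N by apply: (iter_order_in (S := [pred d | D d])).
have x_inj i j : (i < n)%N -> (j < n)%N -> x i = x j -> i = j.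
  move=> hi hj; have := orbit_uniq s d0; rewrite /orbit.
  move=> /(nth_uniq d0); rewrite size_traject => /(_ i j hi hj).
  by move=> uq h; apply/eqP; rewrite -uq !nth_traject //; apply/eqP.
have x_neq i j : x i <> tau (x j) /\ x i <> rho (x j).
  have [ij|/ltnW ij] := leqP j i.
    by rewrite /x -(subnK ij) iterD; apply: neq; apply: xD.
  have := neq (j - i)%N (x i) (xD i); rewrite -iterD subnK // -/(x j) => -[h1 h2].
  have [_ rK _] := rhoP _ (xD j); have [_ tK _] := tauP _ (xD j).
  have [_ rK' _] := rhoP _ (xD i); have [_ tK' _] := tauP _ (xD i).
  by split=> h; [apply: h1|apply: h2]; rewrite h ?tK ?rK.
have n_gt0 : (0 < n)%N by apply: order_gt0.
have x_ordS (i : 'I_n) : x (ordS i) = s (x i).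
  rewrite (_ : s (x i) = x i.+1) // [nat_of_ord (ordS i)]/=.
  have [->|iN] := eqVneq i.+1 n; first by rewrite modnn xn.
  by rewrite modn_small // ltn_neqAle iN ltn_ord.
pose v (i : 'I_n) := (x i).1; pose e (i : 'I_n) := (x i).2.
have eE i : e i \in E by have /and3P[] := xD i.
have vJ i : v i \in J by have /and3P[] := xD i.
have ve i : v i \in e i by have /and3P[] := xD i.
have vS i : v (ordS i) = ov (x i) by rewrite /v x_ordS.
have eJ i : e i :&: J = [set v i; v (ordS i)] by rewrite vS; case: (ovP _ (xD i)).
have x_ord_inj (i j : 'I_n) : x i = x j -> i = j.
  by move/x_inj => h; apply: val_inj; apply: h.
have v_inj : injective v.
  move=> i j /(tauE _ _ (xD i) (xD j))[/esym/x_ord_inj //|h].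
  by have [] := x_neq j i.
have e_inj : injective e.
  move=> i j /(rhoE _ _ (xD i) (xD j))[/esym/x_ord_inj //|h].
  by have [] := x_neq j i.
(* The two edges at [v i] are [e i] and its predecessor. *)
have vE i f : f \in E -> v i \in f -> f = e i \/ exists j, f = e j /\ i = ordS j.
  move=> fE vf; have Df : D (v i, f) by rewrite /D /= fE vf vJ.
  have [/(congr1 snd)|/(congr1 snd) /= fe] := tauE _ _ (xD i) Df erefl; first by left.
  right; exists (ord_pred i); rewrite ord_predK; split => //.
  have [Dr _ _] := rhoP _ (xD (ord_pred i)); have [_ tK _] := tauP _ Dr.
  have xi : x i = tau (rho (x (ord_pred i))) by rewrite -[in LHS](ord_predK i) x_ordS.
  by move: tK; rewrite -xi => /(congr1 snd) /=; rewrite -fe.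
have near u i f : f \in E -> u \in e i -> u \in f -> exists j, f = e j.
  move=> fE ue uf; have [uJ|uJ] := boolP (u \in J); last first.
    by exists i; apply: (not_joint_uniq uJ).
  have : u \in [set v i; v (ordS i)] by rewrite -eJ in_setI ue.
  by rewrite in_set2 => /orP[] /eqP uv; rewrite uv in uf;
    have [->|[j [-> _]]] := vE _ f fE uf; eexists.
have cov u : exists i, u \in e i.
  have /connectP[p pp ->] := conn (v (Ordinal n_gt0)) u.
  have : exists i, v (Ordinal n_gt0) \in e i by exists (Ordinal n_gt0).
  elim: p (v _) pp => //= a p IH b /andP[/exists_inP[f fE /andP[bf af]] pp] [i bi].
  by apply: IH pp _; have [j fj] := near b i f fE bi bf; exists j; rewrite -fj.
(* The default of [nth] is never reached: exactly k - 2 vertices of the edge are not joints. *)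
pose w (p : 'I_n * 'I_(k - 2)) := nth (v p.1) (enum (e p.1 :\: J)) p.2.
have size_e i : size (enum (e i :\: J)) = (k - 2)%N.
  by rewrite -cardE cardsD (edges_uniform (eE i)) e2.
have we p : w p \in e p.1 :\: J by rewrite -mem_enum mem_nth // size_e.
have wJ p : w p \notin J by have := we p; rewrite in_setD => /andP[].
have we' p : w p \in e p.1 by have := we p; rewrite in_setD => /andP[].
exists n; split.
  (* An orbit of length 1 is impossible, since each step moves the joint. *)
  rewrite ltn_neqAle n_gt0 andbT; apply/eqP => n1.
  have h : s d0 = d0 by have := xn; rewrite -n1.
  have := congr1 fst h; have [_ /eqP] := ovP _ D0; exact.
exists v, w, e; split; [split|split; [split|split]] => //.
- move=> [i a] [j b] ww; have ij : i = j.
    have wj : w (i, a) \in e j by rewrite ww; exact: (we' (j, b)).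
    exact: e_inj (not_joint_uniq (wJ (i, a)) (eE i) (eE j) (we' (i, a)) wj).
  rewrite -{}ij in ww *; congr (_, _); apply: val_inj; apply/eqP => /=.
  by rewrite -(nth_uniq (v i) _ _ (enum_uniq (e i :\: J))) ?size_e //; apply/eqP.
- by move=> i p; apply: contraNneq (wJ p) => <-.
- move=> i; apply/setP => u; rewrite in_setU -eJ in_setI.
  have [ue|ue] := boolP (u \in e i) => /=; last first.
    by apply/esym/negP => /imsetP[a _ ua]; rewrite ua (we' (i, a)) in ue.
  have [//|uJ] := boolP (u \in J); apply/esym/imsetP.
  have ui : u \in enum (e i :\: J) by rewrite mem_enum in_setD uJ.
  have hi : (index u (enum (e i :\: J)) < k - 2)%N by rewrite -(size_e i) index_mem.
  by exists (Ordinal hi) => //; rewrite /w /= nth_index.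
- apply/setP => f; apply/idP/imsetP => [fE|[i _ ->] //].
  have /card_gt0P[u uf] : (0 < #|f|)%N by rewrite (edges_uniform fE); lia.
  by have [i ui] := cov u; have [j ->] := near u i f fE ui uf; exists j.
- move=> p; rewrite /degree (_ : [set _ in _ | _] = [set e p.1]) ?cards1 //.
  apply/setP => f; rewrite inE in_set1; apply/andP/eqP => [[fE wf]|-> //].
  exact: (not_joint_uniq (wJ p)).
move=> u; have [i ui] := cov u; have [uJ|uJ] := boolP (u \in J).
  have : u \in [set v i; v (ordS i)] by rewrite -eJ in_setI ui.
  by rewrite in_set2 => /orP[] /eqP ->; left; eexists.
right; have ue : u \in enum (e i :\: J) by rewrite mem_enum in_setD uJ.
have hi : (index u (enum (e i :\: J)) < k - 2)%N by rewrite -(size_e i) index_mem.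
by exists (i, Ordinal hi); rewrite /w /= nth_index.
Qed.

(** * The dichotomy *)

(** Connectedness means one component, and an integer m (k-1) - n + 1 > 0 says n <= m (k-1). *)
Lemma card_vertices_le (k : nat) (V : finType) (H : kgraph k V) :
    kgraph_connected H -> 0 < cyclomatic H ->
  (#|V| <= #|edges H| * k.-1)%N.
Proof.
move=> [/card_gt0P[v _] conn].
rewrite /cyclomatic /num_components.
rewrite (@eq_n_comp_r _ _ _ (connect (adjacent H) v)); last first.
  by move=> u; rewrite !inE /= [RHS]conn.
rewrite n_comp_connect; first by lia.
apply: sym_connect_sym => a b; apply/exists_inP/exists_inP => -[e eH];
  by rewrite andbC; exists e.
Qed.

(** Every vertex that [f] shares with the cover of [F] becomes a joint, and old joints remain
    joints. *)
Lemma core_add (V : finType) (F : {set {set V}}) (f : {set V}) :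
  is_core F -> f \notin F -> (1 < #|f :&: cover F|)%N -> is_core (f |: F).
Proof.
move=> /coreP Fcore fF f2; apply/coreP => e /setU1P[->|eF].
  apply: leq_trans f2 _; apply/subset_leq_card/subsetP => v.
  rewrite !in_setI => /andP[vf /bigcupP[g gF vg]]; rewrite vf /=.
  apply/jointP; exists f, g; rewrite setU11 setU1r //; split => //.
  by apply: contraNneq fF => ->.
apply: leq_trans (Fcore e eF) _; apply/subset_leq_card/setIS.
by apply: joints_sub; apply: subsetUr.
Qed.

Lemma connected_sub_cover (k : nat) (V : finType) (H : kgraph k V)
    (F : {set {set V}}) :
    (0 < k)%N -> kgraph_connected H -> F \subset edges H -> cover F != set0 ->
    {in edges H, forall f : {set V}, f :&: cover F != set0 -> f \in F} ->
  F = edges H.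
Proof.
move=> k0 [_ conn] FH /set0Pn[a aF] closedF.
have allF u : u \in cover F.
  have /connectP[p pp ->] := conn a u.
  elim: p a aF pp => //= b p IH a aF /andP[/exists_inP[f fH /andP[af bf]]].
  apply: IH; apply/bigcupP; exists f => //; apply: closedF => //.
  by apply/set0Pn; exists a; rewrite in_setI af.
apply/eqP; rewrite eqEsubset FH; apply/subsetP => f fH; apply: closedF => //.
have /card_gt0P[u uf] : (0 < #|f|)%N by rewrite (edges_uniform fH).
by apply/set0Pn; exists u; rewrite in_setI uf allF.
Qed.

Theorem theorem4p3 (R : realType) (k : nat) (V : finType) (H : kgraph k V)
    (hk : (3 <= k)%N) (hconn : kgraph_connected H) (hc : 0 < cyclomatic H)
    (hcycle : ~ is_loose_cycle H) :
  alpha R H < alpha_star R.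
Proof.
have k1 : (1 < k)%N by exact: ltnW hk.
have k0 : (0 < k)%N by exact: ltnW k1.
have VE := card_vertices_le hconn hc.
have E0 : edges H != set0.
  apply: contraTneq VE => ->; rewrite cards0 mul0n -ltnNge; exact: hconn.1.
have [F0 [F0E F0n F0core]] : exists F : {set {set V}},
    [/\ F \subset edges H, F != set0 & is_core F].
  apply: (exists_core k0) => //; first by move=> e; apply: edges_uniform.
  by apply: leq_trans VE; apply: max_card.
pose P (F : {set {set V}}) := (F \subset edges H) && is_core F.
have [F /maxsetP[/andP[FE Fcore] Fmax] F0F] : {F | maxset P F & F0 \subset F}.
  by apply: maxset_exists; rewrite /P F0E.
have cF0 : cover F != set0.
  have /set0Pn[e /(subsetP F0F) eF] := F0n.
  have /card_gt0P[u ue] : (0 < #|e|)%N by rewrite (edges_uniform (subsetP FE e eF)).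
  by apply/set0Pn; exists u; apply/bigcupP; exists e.
have [/existsP[v v3]|/existsPn v2] := boolP [exists v, 2 < #|[set e in F | v \in e]|]%N.
  exact: alpha_lt_of_triple_joint v3.
have [/exists_inP[e eF e3]|/exists_inPn e2] :=
    boolP [exists e in F, 2 < #|e :&: joints F|]%N.
  exact: alpha_lt_of_triple_edge e3.
have [/exists_inP[f fE /andP[fF fc]]|/exists_inPn noF] :=
    boolP [exists f in edges H, (f \notin F) && (f :&: cover F != set0)].
  (* A second common vertex would make [f |: F] a larger core. *)
  have f1 : (#|f :&: cover F| <= 1)%N.
    rewrite leqNgt; apply/negP => f2; have := Fmax (f |: F) _ (subsetUr _ _).
    rewrite /P subUset sub1set fE FE core_add // => /(_ isT)/setP/(_ f).
    by rewrite setU11 (negPf fF).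
  have /eqP/cards1P[p fp] : #|f :&: cover F| = 1%N.
    by apply/eqP; rewrite eqn_leq f1 card_gt0.
  have [pJ|pJ] := boolP (p \in joints F).
    exact: alpha_lt_of_pendant_joint fE fp pJ.
  have := set11 p; rewrite -fp in_setI => /andP[_ /bigcupP[e eF pe]].
  exact: alpha_lt_of_pendant_edge fE fp eF pe pJ.
have FEq : F = edges H.
  apply: connected_sub_cover => // f fE fc.
  by have := noF f fE; rewrite fc andbT negbK.
case: hcycle; apply: loose_cycle_of_regular => //; rewrite -FEq.
  by move=> e eF; apply/eqP; rewrite eqn_leq (coreP _ Fcore) // leqNgt e2.
by move=> v; rewrite leqNgt v2.
Qed.
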